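(* Let $k \ge 1$ and let $t_1, t_2, \dots, t_k$ be positive integers such that $t := t_1 + t_2 + \dots + t_k > k$. Let $P_{t_1,\dots,t_k}(q) := \sum_{n\ge 1} p(n,t_1,t_2,\dots,t_k)\,q^n$, where $p(n,t_1,\dots,t_k)$ is the number of partitions of $n$ such that, if $\sigma$ is the smallest part, then $\sigma + t_1 + t_2 + \dots + t_k$ is the largest part and each of $\sigma + t_1$, $\sigma + t_1 + t_2$, $\dots$, $\sigma + t_1 + \dots + t_{k-1}$ appears as a part. Then $$P_{t_1,\dots,t_k}(q) = \frac{(-1)^k\, q^{T - \binom{k+1}{2}} \left( \displaystyle\sum_{j=0}^{k} \left[ {t \atop j} \right] (-1)^j q^{\binom{j+1}{2}} - (q)_t \right)}{\left[ {t-1 \atop k} \right] (1-q^t)\,(q)_t},$$ where $T := k t_1 + (k-1) t_2 + \dots + 2 t_{k-1} + t_k$.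
   Context: A partition of a positive integer $n$ is a finite weakly decreasing sequence of positive integers (its parts) with sum $n$. Notation: $(q)_m := (1-q)(1-q^2)\cdots(1-q^m)$ for $m \ge 0$ (so $(q)_0 = 1$), and $\left[ {A \atop B} \right] := \frac{(q)_A}{(q)_B\,(q)_{A-B}}$ for integers $0 \le B \le A$ (the $q$-binomial coefficient). The identity is an identity of formal power series in $q$, rational functions being expanded at $q=0$. *)

(* Defs.v *)
From HB Require Import structures.
From mathcomp Require Import all_boot all_order all_algebra.
Set Implicit Arguments.
Unset Strict Implicit.
Unset Printing Implicit Defensive.
Import GRing.Theory.
Local Open Scope ring_scope.

Definition is_partition (n : nat) (s : seq nat) : bool :=
  [&& sorted geq s, all (leq 1) s & sumn s == n].

(* A partition is listed in weakly decreasing order. *)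
Definition largest_part (s : seq nat) : nat := head 0%N s.
Definition smallest_part (s : seq nat) : nat := last 0%N s.

(* [sumn (take i t)] is t_1 + ... + t_i. *)
Definition prescribed_parts (t s : seq nat) : bool :=
  let sigma := smallest_part s in
  (largest_part s == sigma + sumn t)%N
  && all (fun i => (sigma + sumn (take i t))%N \in s) (iota 1 (size t).-1).

(* A partition of n has at most n parts, each at most n, so the finite type of
   sequences below contains all of them; see [card_prescribed_partitions]. *)
Definition prescribed_partitions (n : nat) (t : seq nat) :
    {set n.-bseq 'I_n.+1} :=
  [set s : n.-bseq 'I_n.+1 |
    let p := [seq val i | i <- s] in is_partition n p && prescribed_parts t p].

Lemma is_partition_bounds n s : is_partition n s ->
  (size s <= n)%N /\ all (leq^~ n) s.
Proof.
case/and3P=> _ pos /eqP <-; elim: s pos => //= x s IH /andP[x0 /IH[le_s all_s]].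
split; first by rewrite -add1n leq_add.
rewrite leq_addr /=; apply: sub_all all_s => y /= le_y.
by rewrite (leq_trans le_y) ?leq_addl.
Qed.

Lemma card_prescribed_partitions n t (L : seq (seq nat)) : uniq L ->
  (forall s, (s \in L) = is_partition n s && prescribed_parts t s) ->
  #|prescribed_partitions n t| = size L.
Proof.
move=> uL memL; rewrite cardE -(size_map (fun s : n.-bseq _ => map val s)).
apply: perm_size; apply: uniq_perm => //.
  rewrite map_inj_uniq ?enum_uniq // => s1 s2 /(inj_map val_inj).
  exact: val_inj.
move=> s; apply/mapP/idP=> [[b]|].
  by rewrite mem_enum inE memL => ? ->.
rewrite memL => Ps; have /andP[/is_partition_bounds[size_s le_s] _] := Ps.
have size_m : (size [seq inord i : 'I_n.+1 | i <- s] <= n)%N by rewrite size_map.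
have def_s : [seq val i | i <- [seq inord i : 'I_n.+1 | i <- s]] = s.
  rewrite -map_comp -[RHS]map_id; apply/eq_in_map=> i /(allP le_s) le_i /=.
  by rewrite inordK.
by exists (Bseq size_m); rewrite ?mem_enum ?inE /= def_s.
Qed.

(* The power series sum_{n >= 1} p(n, t_1, ..., t_k) q^n, as the sequence of
   its coefficients. *)
Definition P_series (t : seq nat) (n : nat) : rat :=
  if n == 0%N then 0 else #|prescribed_partitions n t|%:R.

Notation ratfun := {fraction {poly rat}}.

Definition q : ratfun := tofrac 'X.

Definition qpoch (m : nat) : ratfun := \prod_(1 <= i < m.+1) (1 - q ^+ i).

(* Meaningful for B <= A only, as [A - B] is truncated. *)
Definition qbinom (A B : nat) : ratfun :=
  qpoch A / (qpoch B * qpoch (A - B)).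

(* [s] is the coefficient sequence of the expansion of F at q = 0: F = N / D
   with D(0) <> 0, and D s = N as formal power series (Cauchy product). *)
Definition expansion_at0 (F : ratfun) (s : nat -> rat) : Prop :=
  exists N D : {poly rat},
    [/\ D.[0] != 0, F = tofrac N / tofrac D
      & forall n, \sum_(i < n.+1) D`_i * s (n - i)%N = N`_n].

(* Main.v *)
(* Partitions with smallest part s are counted by
   x^(k+1) q^T / ((1 - x) (1 - x q) ... (1 - x q^t)) at x = q^s.  With
   u_k(s) = x^k / ((1 - x) ... (1 - x q^(t-1))) at x = q^s, the difference
   u_k(s) - u_k(s+1) is a combination of the terms for k - 1 and k, so the sums
   S_k over s >= 1 of x^(k+1) / ((1 - x) ... (1 - x q^t)) satisfy
   (q)_t (1 - q^k) S_(k-1) + (q)_t (q^k - q^t) S_k = q^k for 1 <= k < t, and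
   (q)_t (1 - q^t) S_0 = 1 - (q)_t; the closed form obeys the same recurrence.
   Power series are handled through polynomials modulo q^(n+1), in which
   1 / (1 - q^b) becomes the finite sum [geom n b]. *)

Require Import Defs.
From HB Require Import structures.
From mathcomp Require Import all_boot all_order all_algebra.
From mathcomp Require Import ring zify.
Set Implicit Arguments.
Unset Strict Implicit.
Unset Printing Implicit Defensive.
Import GRing.Theory.
Local Open Scope ring_scope.

(** * Congruence modulo 'X^(n+1) and products of polynomials with power series *)

Section Truncation.
Variable R : comNzRingType.
Implicit Types (p r : {poly R}) (s : nat -> R) (A : nat -> {poly R}).

(** Congruence modulo 'X^(n+1), encoded as an equality of truncations so that it inherits
    reflexivity, symmetry and transitivity. *)
Definition eqmodX n p r := take_poly n.+1 p = take_poly n.+1 r.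

Lemma eqmodXP n p r :
  eqmodX n p r <-> forall i, (i <= n)%N -> p`_i = r`_i.
Proof.
split=> [e i le_i | e]; last first.
  by apply/polyP=> i; rewrite !coef_take_poly ltnS; case: leqP => // /e.
by have /polyP/(_ i) := e; rewrite !coef_take_poly ltnS le_i.
Qed.

Lemma eqmodX_coef n p r : eqmodX n p r -> p`_n = r`_n.
Proof. by move/eqmodXP; apply. Qed.

Lemma eqmodX_sym n p r : eqmodX n p r -> eqmodX n r p. Proof. by []. Qed.

Lemma eqmodX_trans n p r u : eqmodX n p r -> eqmodX n r u -> eqmodX n p u.
Proof. exact: etrans. Qed.

Lemma eqmodX_le m n p r : (m <= n)%N -> eqmodX n p r -> eqmodX m p r.
Proof.
move=> le_mn /eqmodXP e; apply/eqmodXP=> i le_im.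
by rewrite e // (leq_trans le_im).
Qed.

Lemma eqmodXD n p1 r1 p2 r2 :
  eqmodX n p1 r1 -> eqmodX n p2 r2 -> eqmodX n (p1 + p2) (r1 + r2).
Proof. by rewrite /eqmodX !raddfD /= => -> ->. Qed.

Lemma eqmodXB n p1 r1 p2 r2 :
  eqmodX n p1 r1 -> eqmodX n p2 r2 -> eqmodX n (p1 - p2) (r1 - r2).
Proof. by rewrite /eqmodX !raddfB /= => -> ->. Qed.

Lemma eqmodXM n p1 r1 p2 r2 :
  eqmodX n p1 r1 -> eqmodX n p2 r2 -> eqmodX n (p1 * p2) (r1 * r2).
Proof.
move=> /eqmodXP e1 /eqmodXP e2; apply/eqmodXP=> i le_i.
rewrite !coefM; apply: eq_bigr => j _.
by rewrite e1 ?e2 // (leq_trans _ le_i) ?leq_subr // -ltnS.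
Qed.

Lemma eqmodXMl n p r1 r2 : eqmodX n r1 r2 -> eqmodX n (p * r1) (p * r2).
Proof. exact: eqmodXM. Qed.

Lemma eqmodX_sum n I (e : seq I) (P : pred I) (F G : I -> {poly R}) :
    (forall i, P i -> eqmodX n (F i) (G i)) ->
  eqmodX n (\sum_(i <- e | P i) F i) (\sum_(i <- e | P i) G i).
Proof.
move=> eFG; apply: (big_ind2 (eqmodX n)) => // p1 r1 p2 r2; exact: eqmodXD.
Qed.

Lemma eqmodX_prod n I (e : seq I) (P : pred I) (F G : I -> {poly R}) :
    (forall i, P i -> eqmodX n (F i) (G i)) ->
  eqmodX n (\prod_(i <- e | P i) F i) (\prod_(i <- e | P i) G i).
Proof.
move=> eFG; apply: (big_ind2 (eqmodX n)) => // p1 r1 p2 r2; exact: eqmodXM.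
Qed.

Lemma eqmodX_sum0 n I (e : seq I) (P : pred I) (F : I -> {poly R}) :
  (forall i, P i -> eqmodX n (F i) 0) -> eqmodX n (\sum_(i <- e | P i) F i) 0.
Proof.
by move=> eF; apply: eqmodX_trans (eqmodX_sum _ eF) _; rewrite big1_eq.
Qed.

Lemma eqmodX_prod1 n I (e : seq I) (P : pred I) (F : I -> {poly R}) :
  (forall i, P i -> eqmodX n (F i) 1) -> eqmodX n (\prod_(i <- e | P i) F i) 1.
Proof.
by move=> eF; apply: eqmodX_trans (eqmodX_prod _ eF) _; rewrite big1_eq.
Qed.

Lemma eqmodX_XnM0 n m p : (n < m)%N -> eqmodX n ('X^m * p) 0.
Proof.
move=> lt_nm; apply/eqmodXP=> i le_i.
by rewrite coefXnM coef0 (leq_ltn_trans le_i).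
Qed.

(* The product of [p] by the power series with coefficients [s]. *)
Definition act p s n := \sum_(i < n.+1) p`_i * s (n - i)%N.

(** [A n] represents the power series [s] up to degree [n]; products of series can then be computed
    as products of polynomials. *)
Definition truncates A s := forall m n, (m <= n)%N -> (A n)`_m = s m.

Lemma truncates_act p A s n : truncates A s -> act p s n = (p * A n)`_n.
Proof.
by move=> As; rewrite coefM; apply: eq_bigr => i _; rewrite As ?leq_subr.
Qed.

Lemma truncates_poly s : truncates (fun n => \poly_(i < n.+1) s i) s.
Proof. by move=> m n le_mn; rewrite coef_poly ltnS le_mn. Qed.

Lemma truncatesM p A s :
  truncates A s -> truncates (fun n => p * A n) (act p s).
Proof.
move=> As m n le_mn; rewrite coefM; apply: eq_bigr => i _; rewrite As //.
by rewrite (leq_trans _ le_mn) ?leq_subr.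
Qed.

Lemma actM p r s n : act (p * r) s n = act p (act r s) n.
Proof.
have As := @truncates_poly s.
by rewrite (truncates_act _ _ As) (truncates_act _ _ (truncatesM r As)) mulrA.
Qed.

Lemma actXS s p n : act (p * 'X) s n.+1 = act p s n.
Proof.
rewrite /act big_ord_recl coefMX eqxx mul0r add0r.
by apply: eq_bigr => i _; rewrite coefMX /= subSS.
Qed.

End Truncation.

(** * Expansions of rational functions *)

(* [D] may vanish at 0 here, which allows dividing by any nonzero polynomial;
   [expansion_of_weak] cancels the common power of 'X afterwards. *)
Definition weak_expansion (F : ratfun) (s : nat -> rat) :=
  exists N D : {poly rat},
    [/\ D != 0, F = tofrac N / tofrac D & forall n, act D s n = N`_n].

(** If D(0) = 0, then D s = N forces N(0) = 0, so a factor 'X cancels from both; the induction on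
    [D] repeats this until D(0) is nonzero. *)
Lemma expansion_of_weak F s : weak_expansion F s -> expansion_at0 F s.
Proof.
case=> N [D [D0 -> DsN]]; elim/poly_ind: D N D0 DsN => [|D c IH] N.
  by rewrite eqxx.
have [-> | c0] := eqVneq c 0; last first.
  move=> D0 DsN; exists N, (D * 'X + c%:P); split=> //.
  by rewrite !hornerE.
rewrite addr0 => DX0 DsN.
have D0 : D != 0 by apply: contraNneq DX0 => ->; rewrite mul0r.
have: N`_0 = 0 by rewrite -DsN /act big_ord_recl big_ord0 coefMX mul0r addr0.
elim/poly_ind: N DsN => [|N c' _] DsN.
  move=> _; rewrite rmorph0 mul0r; have := IH 0 D0.
  by rewrite rmorph0 mul0r; apply=> n; rewrite -actXS DsN !coef0.
rewrite coefD coefMX coefC /= add0r => c'0; rewrite c'0 addr0 in DsN *.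
have X0 : tofrac 'X != 0 :> ratfun by rewrite tofrac_eq0 polyX_eq0.
rewrite !rmorphM /= -mulf_div divff // mulr1; apply: IH => // n.
by rewrite -actXS DsN coefMX.
Qed.

Lemma solve_fracE (F : fieldType) (A Q P N D : F) : D != 0 -> P != 0 ->
  (A - Q * (N / D)) / P = (D * A - Q * N) / (D * P).
Proof. by move=> D0 P0; field; rewrite D0 P0. Qed.

(** Multiplying P s + Q r = A by the denominator D of [F] and using D r = N gives (D P) s = D A - Q
    N. *)
Lemma weak_expansion_solve F r s (P Q A : {poly rat}) : P != 0 ->
    weak_expansion F r -> (forall n, act P s n + act Q r n = A`_n) ->
  weak_expansion ((tofrac A - tofrac Q * F) / tofrac P) s.
Proof.
move=> P0 [N [D [D0 -> DrN]]] PQA.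
exists (D * A - Q * N), (D * P); split; first by rewrite mulf_neq0.
  by rewrite rmorphB !rmorphM solve_fracE ?tofrac_eq0.
move=> n; rewrite actM coefB.
have -> : (D * A)`_n = act D (act P s) n + act D (act Q r) n.
  by rewrite coefM -big_split; apply: eq_bigr => i _; rewrite -PQA mulrDr.
suff -> : (Q * N)`_n = act D (act Q r) n by rewrite addrK.
by rewrite -actM [D * Q]mulrC actM coefM; apply: eq_bigr => i _; rewrite DrN.
Qed.

Lemma weak_expansion_eq F s s' : s =1 s' -> weak_expansion F s ->
  weak_expansion F s'.
Proof.
move=> eq_s [N [D [D0 -> DsN]]]; exists N, D; split=> // n.
by rewrite -DsN; apply: eq_bigr => i _; rewrite eq_s.
Qed.

Lemma weak_expansion_act F s (P : {poly rat}) :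
  weak_expansion F s -> weak_expansion (tofrac P * F) (act P s).
Proof.
case=> N [D [D0 -> DsN]]; exists (P * N), D; split=> //.
  by rewrite rmorphM mulrA.
move=> n; rewrite -actM mulrC actM coefM.
by apply: eq_bigr => i _; rewrite DsN.
Qed.

(** * Sums over the smallest part and their recurrence *)

Section Series.
Variable R : comNzRingType.

Definition geom n b : {poly R} := \sum_(m < n.+1) 'X^(m * b).

Lemma geom_mul n b : (0 < b)%N -> eqmodX n ((1 - 'X^b) * geom n b) 1.
Proof.
move=> b0.
have -> : (1 - 'X^b) * geom n b = 1 - 'X^(b * n.+1) * 1.
  rewrite mulr1 exprM -[RHS]opprB subrX1 -mulNr opprB; congr (_ * _).
  by apply: eq_bigr => i _; rewrite mulnC exprM.
rewrite -[X in eqmodX n _ X]subr0; apply: eqmodXB => //.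
by apply: eqmodX_XnM0; rewrite leq_pmull.
Qed.

(** Both sides invert 1 - 'X^b modulo 'X^(m+1), and inverses are unique. *)
Lemma geom_le m n b : (m <= n)%N -> (0 < b)%N ->
  eqmodX m (geom n b) (geom m b).
Proof.
move=> le_mn b0.
have e1 := geom_mul m b0; have e2 := eqmodX_le le_mn (geom_mul n b0).
apply: (@eqmodX_trans _ _ _ (geom n b * ((1 - 'X^b) * geom m b))).
  by rewrite -[X in eqmodX _ X _]mulr1; apply/eqmodXMl/eqmodX_sym.
rewrite mulrCA mulrA -[X in eqmodX _ _ X]mul1r.
by apply: eqmodXM.
Qed.

Lemma geom_large n b : (n < b)%N -> eqmodX n (geom n b) 1.
Proof.
move=> lt_nb; rewrite /geom big_ord_recl -[X in eqmodX _ _ X]addr0.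
apply: eqmodXD => //; apply: eqmodX_sum0 => i _.
rewrite -['X^_]mulr1; apply: eqmodX_XnM0.
by rewrite (leq_trans lt_nb) ?leq_pmull.
Qed.

(** Truncated form of 1 / ((1 - q^s) ... (1 - q^(s+t-1))), with [t] factors. *)
Definition geoms n t s := \prod_(i < t) geom n (s + i).

Lemma geomsS n t s : geoms n t.+1 s = geom n s * geoms n t s.+1.
Proof.
rewrite /geoms big_ord_recl addn0; congr (_ * _).
by apply: eq_bigr => i _; rewrite addSnnS.
Qed.

Lemma geomsSr n t s : geoms n t.+1 s = geoms n t s * geom n (s + t).
Proof. by rewrite /geoms big_ord_recr. Qed.

(* For [0 < j], only the coefficients up to [n] of [shifted_sum t j n] are
   meaningful: it truncates the sum over [s >= 1] of
   q^(j s) / ((1 - q^s) ... (1 - q^(s+t))). *)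
Definition shifted_sum t j n :=
  \sum_(1 <= s < n.+1) 'X^(j * s) * geoms n t.+1 s.

Definition shifted_series t j n := (shifted_sum t j n)`_n.

(** Modulo 'X^(m+1) the terms with s > m vanish because j > 0, and the other terms differ only in
    the cut-off of each [geom]. *)
Lemma truncates_shifted_sum t j : (0 < j)%N ->
  truncates (shifted_sum t j) (shifted_series t j).
Proof.
move=> j0 m n le_mn; apply: eqmodX_coef.
rewrite /shifted_sum (big_cat_nat _ (n := m.+1)) ?ltnS //=.
rewrite -[X in eqmodX _ _ X]addr0.
apply: eqmodXD.
  rewrite !big_seq; apply: eqmodX_sum => s.
  rewrite mem_index_iota => /andP[s0 _].
  apply/eqmodXMl/eqmodX_prod => i _; apply: geom_le => //.
  by rewrite (leq_trans s0) ?leq_addr.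
rewrite big_seq; apply: eqmodX_sum0 => s.
rewrite mem_index_iota => /andP[lt_ms _].
by apply: eqmodX_XnM0; rewrite (leq_trans lt_ms) ?leq_pmull.
Qed.

Definition qpochp t : {poly R} := \prod_(1 <= i < t.+1) (1 - 'X^i).

Lemma qpochp_geoms n t : eqmodX n (qpochp t * geoms n t 1) 1.
Proof.
rewrite /qpochp /geoms big_add1 big_mkord -big_split /=.
by apply: eqmodX_prod1 => i _; apply: geom_mul.
Qed.

(** For x = q^s, (1 - q^k) x^k + (q^k - q^t) x^(k+1) = x^k (1 - x q^t) - (x q)^k (1 - x). Divided by
    (1 - x) ... (1 - x q^t), the right side becomes [u s - u s.+1], so the sum telescopes; (q)_t
    cancels the denominator of [u 1]. *)
Lemma shifted_sum_rec t k n : (k <= t)%N ->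
  eqmodX n (qpochp t * (1 - 'X^k) * shifted_sum t k n
            + qpochp t * ('X^k - 'X^t) * shifted_sum t k.+1 n)
           ('X^k - (k == 0%N)%:R * qpochp t).
Proof.
move=> le_kt; pose u s := 'X^(k * s) * geoms n t s.
have step s : (0 < s)%N -> eqmodX n ((1 - 'X^k) * ('X^(k * s) * geoms n t.+1 s)
    + ('X^k - 'X^t) * ('X^(k.+1 * s) * geoms n t.+1 s)) (u s - u s.+1).
  move=> s0.
  have -> : (1 - 'X^k) * ('X^(k * s) * geoms n t.+1 s)
      + ('X^k - 'X^t) * ('X^(k.+1 * s) * geoms n t.+1 s)
    = 'X^(k * s) * ((1 - 'X^(s + t)) * geoms n t.+1 s)
      - 'X^(k * s.+1) * ((1 - 'X^s) * geoms n t.+1 s).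
    by rewrite mulSn mulnS !exprD; ring.
  apply: eqmodXB; apply: eqmodXMl.
    rewrite geomsSr mulrCA -[X in eqmodX _ _ X]mulr1.
    by apply/eqmodXMl/geom_mul; rewrite addn_gt0 s0.
  rewrite geomsS mulrA -[X in eqmodX _ _ X]mul1r.
  by apply: eqmodXM => //; apply: geom_mul.
have sumE : eqmodX n
    ((1 - 'X^k) * shifted_sum t k n + ('X^k - 'X^t) * shifted_sum t k.+1 n)
    (u 1%N - u n.+1).
  rewrite /shifted_sum !mulr_sumr -big_split /= -[u 1%N - _]opprB.
  rewrite -(telescope_sumr u) // -sumrN !big_seq.
  apply: eqmodX_sum => s; rewrite mem_index_iota opprB => /andP[s0 _].
  exact: step.
rewrite -!mulrA -mulrDr; apply: eqmodX_trans (eqmodXMl _ sumE) _.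
rewrite mulrBr; apply: eqmodXB.
  rewrite /u muln1 mulrCA -[X in eqmodX _ _ X]mulr1.
  exact/eqmodXMl/qpochp_geoms.
rewrite [X in eqmodX _ _ X]mulrC; apply: eqmodXMl; rewrite /u.
(* The end term [u n.+1] is divisible by 'X^(n+1) for k > 0 but congruent to 1 for k = 0, which is
   the source of the [k == 0] correction. *)
case: k {step sumE u le_kt} => [|k]; last first.
  by apply: eqmodX_XnM0; rewrite leq_pmull.
rewrite mul0n expr0 mul1r.
by apply: eqmodX_prod1 => i _; apply: geom_large; rewrite ltnS leq_addr.
Qed.

End Series.

(** * The closed form in the field of fractions *)

Lemma oneBXn_neq0 (R : idomainType) i : (0 < i)%N -> 1 - 'X^i != 0 :> {poly R}.
Proof. by move=> i0; rewrite -oppr_eq0 opprB -size_poly_eq0 size_XnsubC. Qed.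

Lemma tofrac_Xn i : tofrac 'X^i = q ^+ i.
Proof. exact: rmorphXn. Qed.

Lemma tofrac_oneBXn i : tofrac (1 - 'X^i) = 1 - q ^+ i.
Proof. by rewrite rmorphB rmorph1 /= tofrac_Xn. Qed.

Lemma q_neq0 : q != 0.
Proof. by rewrite tofrac_eq0 polyX_eq0. Qed.

Lemma oneBqn_neq0 i : (0 < i)%N -> 1 - q ^+ i != 0.
Proof. by move=> i0; rewrite -tofrac_oneBXn tofrac_eq0 oneBXn_neq0. Qed.

Lemma tofrac_qpochp t : tofrac (qpochp _ t) = qpoch t.
Proof. by rewrite rmorph_prod; apply: eq_bigr => i _; exact: tofrac_oneBXn. Qed.

Lemma qpochS t : qpoch t.+1 = qpoch t * (1 - q ^+ t.+1).
Proof. by rewrite /qpoch big_nat_recr. Qed.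

Lemma qpoch0 : qpoch 0 = 1.
Proof. by rewrite /qpoch big_geq. Qed.

Lemma qpoch_neq0 t : qpoch t != 0.
Proof.
elim: t => [|t IH]; first by rewrite qpoch0 oner_eq0.
by rewrite qpochS mulf_neq0 ?oneBqn_neq0.
Qed.

(** Closed form of S_k: the fraction of the theorem divided by q^T. *)
Definition shifted_frac t k : ratfun :=
  (-1) ^+ k * (\sum_(0 <= j < k.+1) qbinom t j * (-1) ^+ j * q ^+ 'C(j.+1, 2)
               - qpoch t)
  / (q ^+ 'C(k.+1, 2) * (qbinom t.-1 k * (1 - q ^+ t) * qpoch t)).

Lemma shifted_frac0 t : (0 < t)%N ->
  shifted_frac t 0 = (1 - qpoch t) / (qpoch t * (1 - q ^+ t)).
Proof.
move=> t0; rewrite /shifted_frac big_nat1 bin_small // !expr0.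
rewrite /qbinom !subn0 qpoch0.
by rewrite !mul1r !mulr1 !divff ?qpoch_neq0 // mul1r [_ * qpoch t]mulrC.
Qed.

(* Here [a], [c], [w], [z] stand for (q)_k, (q)_d, (q)_(t-1), q^C(k+1,2), and
   [x], [y] for q^(k+1), q^(d+1), where t = k + d + 2. *)
Lemma shifted_frac_step (F : fieldType) (a c w z x y S : F) (b : bool) :
    a != 0 -> c != 0 -> w != 0 -> z != 0 -> x != 0 ->
    1 - x != 0 -> 1 - y != 0 -> 1 - x * y != 0 ->
  -1 * (-1) ^+ b
    * (S + w * (1 - x * y) / (a * (1 - x) * (c * (1 - y)))
           * (-1 * (-1) ^+ b) * (x * z) - w * (1 - x * y))
    / (x * z * (w / (a * (1 - x) * c) * (1 - x * y) * (w * (1 - x * y))))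
  = (x - w * (1 - x * y) * (1 - x)
       * ((-1) ^+ b * (S - w * (1 - x * y))
          / (z * (w / (a * (c * (1 - y))) * (1 - x * y) * (w * (1 - x * y))))))
    / (w * (1 - x * y) * (x - x * y)).
Proof.
move=> a0 c0 w0 z0 x0 x1 y1 xy1; have xy : x - x * y != 0.
  by rewrite -[X in X - _]mulr1 -mulrBr mulf_neq0.
(* The sign of the new term cancels the sign in front only through (-1)^(2b) = 1, so both values of
   [b] are evaluated before [field]. *)
case: b; rewrite ?expr0 ?expr1; field;
  by rewrite ?a0 ?c0 ?w0 ?z0 ?x0 ?x1 ?y1 ?xy1 ?xy.
Qed.

(** The recurrence, solved for S_(k+1). Passing from k to k + 1 adds a single term to the sum; the
    earlier terms enter as an arbitrary value [S]. *)
Lemma shifted_fracS t k : (k.+1 < t)%N ->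
  shifted_frac t k.+1
               = (q ^+ k.+1 - qpoch t * (1 - q ^+ k.+1) * shifted_frac t k)
                 / (qpoch t * (q ^+ k.+1 - q ^+ t)).
Proof.
(* Writing t = k + d + 2 turns the truncated subtractions into successors, on which [qpochS]
   acts. *)
move=> lt_kt; have [d def_t] : {d | t = (k.+1 + d).+1}.
  by exists (t - k.+2)%N; rewrite -addSn subnKC.
rewrite /shifted_frac big_nat_recr //=.
set S := \sum_(_ <= _ < _) _; rewrite /qbinom.
have -> : (t.-1 - k = d.+1)%N by lia.
have -> : (t.-1 - k.+1 = d)%N by lia.
have -> : (t - k.+1 = d.+1)%N by lia.
have -> : qpoch t = qpoch t.-1 * (1 - q ^+ t) by rewrite {1}def_t qpochS def_t.
have -> : 'C(k.+2, 2) = (k.+1 + 'C(k.+1, 2))%N by rewrite binS bin1 addnC.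
have t0 : 1 - q ^+ t != 0 by rewrite oneBqn_neq0 // def_t.
have qtE : q ^+ t = q ^+ k.+1 * q ^+ d.+1 by rewrite -exprD def_t addnS.
rewrite qtE in t0 *.
rewrite !qpochS [q ^+ (k.+1 + _)]exprD (exprS (-1) k) -(signr_odd _ k).
have xn0 i : q ^+ i != 0 by rewrite expf_neq0 ?q_neq0.
exact: (shifted_frac_step S (odd k)
  (qpoch_neq0 k) (qpoch_neq0 d) (qpoch_neq0 t.-1) (xn0 'C(k.+1, 2))
  (xn0 k.+1) (oneBqn_neq0 (ltn0Sn k))
  (oneBqn_neq0 (ltn0Sn d)) t0).
Qed.

(** * Expansion of the closed form *)

Lemma qpochp_neq0 t : qpochp rat t != 0.
Proof. by rewrite -tofrac_eq0 tofrac_qpochp qpoch_neq0. Qed.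

Lemma weak_expansion0 : weak_expansion 0 (fun=> 0).
Proof.
exists 0, 1; split; first by rewrite oner_eq0.
  by rewrite rmorph0 mul0r.
by move=> n; rewrite coef0 /act big1 // => i _; rewrite mulr0.
Qed.

(** Induction on [k] along the common recurrence. The coefficient (q)_t (q^j - q^t) to divide by is
    nonzero for j < t, but vanishes at 0 when j > 0; hence the weak form of expansion. *)
Lemma shifted_frac_expansion t k : (k < t)%N ->
  weak_expansion (shifted_frac t k) (shifted_series rat t k.+1).
Proof.
have P0 j : (j < t)%N -> qpochp rat t * ('X^j - 'X^t) != 0.
  move=> lt_jt; rewrite mulf_neq0 ?qpochp_neq0 // -(subnK (ltnW lt_jt)).
  rewrite exprD -[X in X - _]mul1r -mulrBl mulf_neq0 ?expf_neq0 ?polyX_eq0 //.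
  by rewrite oneBXn_neq0 ?subn_gt0.
elim: k => [|k IH] lt_kt.
  (* At index 0 the factor 1 - q^0 kills the preceding sum, so the zero series with coefficient 0
     takes its place. *)
  have recn n : act (qpochp rat t * ('X^0 - 'X^t)) (shifted_series rat t 1) n
      + act 0 (fun=> 0) n = (1 - qpochp rat t)`_n.
    rewrite (truncates_act _ _ (truncates_shifted_sum rat t (ltn0Sn 0))).
    have /eqmodX_coef := @shifted_sum_rec rat t 0 n (leq0n t).
    rewrite expr0 subrr mulr0 mul0r add0r mul1r => ->.
    by rewrite /act big1 ?addr0 // => i _; rewrite mulr0.
  have := weak_expansion_solve (P0 0%N lt_kt) weak_expansion0 recn.
  rewrite shifted_frac0 // mulr0 subr0 rmorphM !rmorphB !rmorph1 /=.
  by rewrite tofrac_qpochp tofrac_Xn.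
have recn n :
    act (qpochp rat t * ('X^(k.+1) - 'X^t)) (shifted_series rat t k.+2) n
    + act (qpochp rat t * (1 - 'X^(k.+1))) (shifted_series rat t k.+1) n
    = ('X^(k.+1) : {poly rat})`_n.
  rewrite !(truncates_act _ _ (truncates_shifted_sum rat t (ltn0Sn _))).
  have /eqmodX_coef := @shifted_sum_rec rat t k.+1 n (ltnW lt_kt).
  by rewrite mul0r subr0 => <-; rewrite coefD addrC.
have := weak_expansion_solve (P0 _ lt_kt) (IH (ltnW lt_kt)) recn.
rewrite shifted_fracS // !rmorphM !rmorphB rmorph1 /=.
by rewrite !tofrac_qpochp !tofrac_Xn.
Qed.

(** * Partial sums of the t_i *)

(** Offsets from the smallest part of all parts that must occur, including 0 for the smallest part
    itself and t for the largest. *)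
Definition psums (ts : seq nat) :=
  [seq sumn (take i ts) | i <- iota 0 (size ts).+1].

Lemma psums_cons a ts :
  psums (a :: ts) = 0%N :: [seq (a + x)%N | x <- psums ts].
Proof.
transitivity
  (0%N :: [seq sumn (take i (a :: ts)) | i <- iota (1 + 0) (size ts).+1]).
  by [].
by rewrite iotaDl -!map_comp.
Qed.

Lemma psums_rcons ts : (0 < sumn ts)%N ->
  psums ts =
    0%N :: rcons [seq sumn (take i ts) | i <- iota 1 (size ts).-1] (sumn ts).
Proof.
case: ts => // a ts _; rewrite /psums [size _]/= -[in LHS]addn1 iotaD map_cat.
by rewrite cats1 add0n take_oversize.
Qed.

Lemma mem_psums0 ts : 0%N \in psums ts.
Proof. by apply/mapP; exists 0%N; rewrite ?take0 ?mem_head. Qed.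

Lemma psums_le ts x : x \in psums ts -> (x <= sumn ts)%N.
Proof.
case/mapP=> i _ ->.
by rewrite -[X in (_ <= sumn X)%N](cat_take_drop i) sumn_cat leq_addr.
Qed.

Lemma uniq_psums ts : all (leq 1) ts -> uniq (psums ts).
Proof.
elim: ts => // a ts IH /andP[a0 /IH u_ts]; rewrite psums_cons cons_uniq.
rewrite map_inj_uniq ?u_ts ?andbT; last exact: addnI.
by apply/mapP=> -[x _]; lia.
Qed.

(** This is T: the entry at index i is a summand of exactly the [size ts - i] later partial sums. *)
Lemma sumn_psums ts :
  sumn (psums ts) = (\sum_(i < size ts) (size ts - i) * nth 0 ts i)%N.
Proof.
elim: ts => [|a ts IH]; first by rewrite big_ord0.
have sumn_addl s : sumn [seq (a + x)%N | x <- s] = (size s * a + sumn s)%N.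
  by elim: s => //= x s ->; lia.
rewrite psums_cons -[LHS]/(sumn (map _ (psums ts))) sumn_addl IH.
rewrite size_map size_iota big_ord_recl.
by congr (_ + _)%N; apply: eq_bigr.
Qed.

(** * Encoding partitions by the multiplicities of their parts *)

Section Counting.
Variable ts : seq nat.
Hypothesis ts_gt0 : (0 < sumn ts)%N.

(** Here the smallest part is a parameter: the offsets 0 and [sumn ts] force both ends of the
    interval to be parts. *)
Definition spans_from s (p : seq nat) :=
  [&& sorted geq p, all (fun x => s <= x <= s + sumn ts)%N p
    & all (fun x => (s + x)%N \in p) (psums ts)].

Let geq_trans : transitive geq := fun y x z yx zy => leq_trans zy yx.

Lemma sorted_geq_bounds (p : seq nat) x :
  sorted geq p -> x \in p -> (last 0%N p <= x <= head 0%N p)%N.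
Proof.
case: p => // a p; rewrite [sorted _ _]/= => pth.
have /allP le_a := order_path_min geq_trans pth.
have le_last y : y \in a :: p -> (last a p <= y)%N.
  elim: p a pth {le_a} y => [|b p IH] a /=.
    by move=> _ y; rewrite inE => /eqP->.
  case/andP=> ba /IH{}IH y; rewrite inE => /predU1P[->|]; last exact: IH.
  by apply: leq_trans ba; apply: IH; rewrite mem_head.
move=> xp; rewrite /= le_last //=.
by move: xp; rewrite inE => /predU1P[->|/le_a].
Qed.

Lemma spans_from_smallest s p : spans_from s p -> smallest_part p = s.
Proof.
case/and3P=> srt /allP bnd /allP req.
have sp : s \in p.
  by rewrite -[s]addn0 req ?mem_psums0.
have /andP[le_ls _] := sorted_geq_bounds srt sp.
apply/eqP; rewrite eqn_leq le_ls /smallest_part /=.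
suff /bnd/andP[] : last 0%N p \in p by [].
by case: p sp {srt bnd req le_ls} => // a p _; apply: mem_last.
Qed.

Lemma prescribedE n p : is_partition n p && prescribed_parts ts p =
  [&& (0 < smallest_part p)%N, spans_from (smallest_part p) p & sumn p == n].
Proof.
(* For the empty list the largest and smallest parts are both 0 by default, while they should differ
   by [sumn ts], which is positive. *)
have [-> | p0] := eqVneq p [::].
  by rewrite /prescribed_parts /largest_part /= add0n ltn_eqF ?andbF.
have last_in : smallest_part p \in p.
  by case: p p0 => // a p _; apply: mem_last.
have head_in : largest_part p \in p.
  by case: p p0 {last_in} => // a p _; apply: mem_head.
apply/idP/idP.
  case/andP=> /and3P[srt /allP pos sum] /andP[/eqP la /allP lb].
  apply/and3P; split=> //; first exact: pos.
  apply/and3P; split=> //; apply/allP=> x.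
    by move/(sorted_geq_bounds srt); rewrite -[head _ _]/(largest_part p) la.
  rewrite psums_rcons // inE mem_rcons inE.
  case/or3P=> [/eqP-> | /eqP-> | /mapP[i i_in ->]]; last exact: lb.
    by rewrite addn0.
  by rewrite -la.
case/and3P=> s0 /and3P[srt /allP bnd /allP req] sum.
rewrite /is_partition srt sum andbT /=; apply/and3P; split.
- by apply/allP=> x /bnd/andP[le_x _]; apply: leq_trans le_x.
- have /andP[_ le_head] := bnd _ head_in; rewrite eqn_leq le_head /=.
  have /req/(sorted_geq_bounds srt)/andP[] // : sumn ts \in psums ts.
  by rewrite psums_rcons // inE mem_rcons mem_head orbT.
apply/allP=> i i_in; apply: req.
rewrite psums_rcons // inE mem_rcons inE.
by rewrite (map_f (fun j => sumn (take j ts)) i_in) !orbT.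
Qed.

(** [f i] is the multiplicity of the part s + i; sorting gives the unique decreasing listing. *)
Definition block_partition n s (f : {ffun 'I_(sumn ts).+1 -> 'I_n.+1}) :
    seq nat :=
  sort geq (flatten [seq nseq (f i) (s + i)%N | i : 'I_(sumn ts).+1]).

Definition multiplicities n s : {set {ffun 'I_(sumn ts).+1 -> 'I_n.+1}} :=
  [set f : {ffun 'I_(sumn ts).+1 -> 'I_n.+1} |
    (\sum_i f i * (s + i) == n)%N
    && [forall i : 'I_(sumn ts).+1, (val i \in psums ts) ==> (0 < f i)%N]].

Section Blocks.
Variables n s : nat.
Implicit Type f : {ffun 'I_(sumn ts).+1 -> 'I_n.+1}.

Let geq_total : total geq. Proof. by move=> x y; apply: leq_total. Qed.

Lemma sumn_block_partition f :
  sumn (block_partition s f) = (\sum_i f i * (s + i))%N.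
Proof.
rewrite (perm_sumn (permEl (perm_sort _ _))) sumn_flatten sumnE -map_comp.
by rewrite big_map big_enum; apply: eq_bigr => i _; rewrite /= sumn_nseq mulnC.
Qed.

Lemma count_block_partition f x :
  count_mem x (block_partition s f) = (\sum_i f i * (s + i == x))%N.
Proof.
rewrite (permP (permEl (perm_sort _ _))) count_flatten sumnE -map_comp.
by rewrite big_map big_enum; apply: eq_bigr => i _; rewrite /= count_nseq mulnC.
Qed.

Lemma count_block_partition_ord f (i : 'I_(sumn ts).+1) :
  count_mem (s + i)%N (block_partition s f) = f i.
Proof.
rewrite count_block_partition (bigD1 i) //= eqxx muln1.
rewrite big1 ?addn0 // => j ne_ji.
by rewrite eqn_add2l (inj_eq val_inj) (negPf ne_ji) muln0.
Qed.

Lemma block_partition_inj : injective (@block_partition n s).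
Proof.
move=> f g eq_fg; apply/ffunP=> i; apply: val_inj.
by rewrite /= -!count_block_partition_ord eq_fg.
Qed.

Lemma block_partition_spans f : f \in multiplicities n s ->
  spans_from s (block_partition s f).
Proof.
rewrite inE => /andP[_ /forallP req]; apply/and3P; split.
- exact: sort_sorted.
- apply/allP=> x; rewrite mem_sort => /flatten_mapP[i _ /nseqP[-> _]].
  by rewrite leq_addr leq_add2l -ltnS ltn_ord.
apply/allP=> x xP; have lt_x : (x < (sumn ts).+1)%N by rewrite ltnS psums_le.
have /implyP/(_ xP) := req (Ordinal lt_x).
by rewrite -has_pred1 has_count -(count_block_partition_ord f (Ordinal lt_x)).
Qed.

Lemma spans_block_partition p : spans_from s p -> sumn p = n -> (0 < s)%N ->
  exists2 f, f \in multiplicities n s & p = block_partition s f.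
Proof.
case/and3P=> srt /allP bnd /allP req sum_p s0.
(* Every copy of a positive part adds at least 1 to the sum n, so all multiplicities fit in
   ['I_n.+1]. *)
have le_count x : (0 < x)%N -> (count_mem x p <= n)%N.
  move=> x0; rewrite -sum_p; elim: {+}p => //= y p' IH.
  by apply: leq_add => //; case: eqP => // ->.
pose f := [ffun i : 'I_(sumn ts).+1 => inord (count_mem (s + i)%N p) : 'I_n.+1].
have fE i : f i = count_mem (s + i)%N p :> nat.
  by rewrite ffunE inordK // ltnS le_count // addn_gt0 s0.
have def_p : p = block_partition s f.
  (* Two sorted lists agree once all multiplicities agree; outside the interval from s to s + t both
     multiplicities are 0. *)
  apply: (sorted_eq geq_trans _ srt (sort_sorted geq_total _)).
    by move=> x y; rewrite andbC -eqn_leq => /eqP.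
  rewrite -/(block_partition s f) /perm_eq; apply/allP=> x _ /=; apply/eqP.
  have [/andP[le_sx le_x] | out] := boolP (s <= x <= s + sumn ts)%N.
    have lt_x : (x - s < (sumn ts).+1)%N by rewrite ltnS leq_subLR.
    have := count_block_partition_ord f (Ordinal lt_x).
    by rewrite fE /= subnKC.
  rewrite (count_memPn _); last by apply: contra out => /bnd.
  rewrite count_block_partition big1 // => i _.
  case: eqP => [def_x|]; last by rewrite muln0.
  by rewrite -def_x leq_addr leq_add2l -ltnS ltn_ord in out.
exists f => //; rewrite inE -sumn_block_partition -def_p sum_p eqxx /=.
apply/forallP=> i; apply/implyP=> /req.
by rewrite fE -has_pred1 has_count.
Qed.

End Blocks.

(** The pairs (s, f) enumerate the partitions without repetition, since s is recovered as the
    smallest part and f as the multiplicities. Being a part, s is at most n. *)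
Lemma card_prescribed n :
  #|prescribed_partitions n ts|
  = (\sum_(1 <= s < n.+1) #|multiplicities n s|)%N.
Proof.
pose L :=
  [seq block_partition s f | s <- iota 1 n, f <- enum (multiplicities n s)].
have smallE s (f : {ffun 'I_(sumn ts).+1 -> 'I_n.+1}) :
    f \in multiplicities n s ->
    smallest_part (block_partition s f) = s.
  by move=> fm; apply/spans_from_smallest/block_partition_spans.
rewrite (@card_prescribed_partitions n ts L).
- rewrite size_allpairs_dep sumnE big_map /index_iota subn1.
  by apply: eq_bigr => s _; rewrite -cardE.
- apply: allpairs_uniq_dep; first exact: iota_uniq.
    by move=> s _; apply: enum_uniq.
  move=> _ _ /allpairsPdep[s [f [_ fm ->]]]
    /allpairsPdep[s' [f' [_ fm' ->]]] /=.
  rewrite !mem_enum in fm fm' => eq_b.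
  have eq_s : s = s' by rewrite -(smallE s f) // eq_b smallE.
  by case: s' / eq_s {fm'} eq_b => /block_partition_inj->.
move=> p; rewrite prescribedE; apply/allpairsPdep/and3P.
  case=> s [f [s_in f_in ->]]; rewrite mem_enum in f_in.
  rewrite smallE // block_partition_spans // sumn_block_partition.
  by move: s_in f_in; rewrite mem_iota inE => /andP[-> _] /andP[-> _].
case=> s0 spn /eqP sum_p.
have [f fm def_p] := spans_block_partition spn sum_p s0.
exists (smallest_part p), f; split; rewrite ?mem_enum //.
rewrite mem_iota s0 /= add1n ltnS.
rewrite -sum_p; case/and3P: spn => _ _ /allP/(_ _ (mem_psums0 ts)).
rewrite addn0 => /perm_to_rem/perm_sumn-> /=; exact: leq_addr.
Qed.

End Counting.

(** * Generating function of the multiplicities *)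

Section GeneratingFunction.
Variables (R : comNzRingType) (ts : seq nat).

(** Expanding the product, each choice [f] of exponents contributes one monomial, of degree the sum
    of the encoded partition. *)
Lemma card_multiplicities n s :
  #|multiplicities ts n s|%:R
  = (\prod_(i < (sumn ts).+1)
       \sum_(m < n.+1 | (val i \in psums ts) ==> (0 < m)%N) 'X^(m * (s + i)))`_n
  :> R.
Proof.
rewrite bigA_distr_big_dep coef_sum -sum1_card natr_sum.
rewrite big_mkcond [RHS]big_mkcond; apply: eq_bigr => f _.
rewrite inE prodrXr coefXn eq_sym andbC.
have -> : (f \in family (fun (i : 'I_(sumn ts).+1) (m : 'I_n.+1) =>
    (val i \in psums ts) ==> (0 < m)%N))
  = [forall i : 'I_(sumn ts).+1, (val i \in psums ts) ==> (0 < f i)%N] by [].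
by rewrite if_and; case: ifP => // _; case: eqP.
Qed.

(** Omitting m = 0 amounts to a factor 'X^b; the extra term 'X^((n+1) b) on the right vanishes
    modulo 'X^(n+1). *)
Lemma geom_positive n b (r : bool) : (0 < b)%N ->
  eqmodX n (\sum_(m < n.+1 | r ==> (0 < m)%N) 'X^(m * b))
           ('X^(r * b) * geom R n b).
Proof.
move=> b0; case: r => /=; last by rewrite mul0n expr0 mul1r.
rewrite mul1n mulr_sumr big_ord_recr big_mkcond big_ord_recl /= add0r.
rewrite -[X in eqmodX _ X]addr0; apply: eqmodXD.
  by under [X in eqmodX _ _ X]eq_bigr do rewrite -exprD -mulSn.
by apply/eqmodX_sym; rewrite -exprD -mulSn -['X^_]mulr1; apply: eqmodX_XnM0;
  rewrite leq_pmulr.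
Qed.

Hypothesis ts_pos : all (leq 1) ts.

(** The weight of one copy of each forced part. Positive entries make the offsets distinct, so the
    sum can be reindexed by [psums ts]. *)
Lemma sum_mem_psums s :
  (\sum_(i < (sumn ts).+1) (val i \in psums ts) * (s + i)
   = (size ts).+1 * s + sumn (psums ts))%N.
Proof.
transitivity (\sum_(0 <= i < (sumn ts).+1 | i \in psums ts) (s + i))%N.
  rewrite [RHS]big_mkcond big_mkord; apply: eq_bigr => i _.
  by case: (_ \in _); rewrite ?mul1n.
rewrite -big_filter (perm_big (psums ts)).
  rewrite big_split big_const_seq count_predT size_map size_iota iter_addn_0.
  by rewrite mulnC -sumnE.
apply: uniq_perm; rewrite ?filter_uniq ?iota_uniq ?uniq_psums // => x.
rewrite mem_filter mem_index_iota ltnS; case xP: (x \in _) => //=.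
by rewrite psums_le.
Qed.

Lemma multiplicities_geoms n s : (0 < s)%N ->
  #|multiplicities ts n s|%:R
  = ('X^(sumn (psums ts))
     * ('X^((size ts).+1 * s) * geoms R n (sumn ts).+1 s))`_n.
Proof.
move=> s0; rewrite card_multiplicities; apply: eqmodX_coef.
rewrite mulrA -exprD addnC -sum_mem_psums -prodrXr -big_split /=.
by apply: eqmodX_prod => i _; apply: geom_positive; rewrite addn_gt0 s0.
Qed.

Lemma prescribed_shifted_sum n : (0 < sumn ts)%N ->
  #|prescribed_partitions n ts|%:R
  = ('X^(sumn (psums ts)) * shifted_sum R (sumn ts) (size ts).+1 n)`_n.
Proof.
move=> t0; rewrite card_prescribed // natr_sum mulr_sumr coef_sum !big_seq.
apply: eq_bigr => s; rewrite mem_index_iota => /andP[s0 _].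
exact: multiplicities_geoms.
Qed.

End GeneratingFunction.

(** * Combining the count with the closed form *)

Lemma P_series_act ts n : all (leq 1) ts -> (0 < sumn ts)%N ->
  P_series ts n =
  act 'X^(sumn (psums ts)) (shifted_series rat (sumn ts) (size ts).+1) n.
Proof.
move=> ts_pos t0.
rewrite (truncates_act _ _ (truncates_shifted_sum _ _ (ltn0Sn _))).
(* At n = 0 the value 0 set in [P_series] agrees with the count, an empty sum over s. *)
rewrite -prescribed_shifted_sum // /P_series; case: eqP => // ->.
by rewrite card_prescribed // big_geq.
Qed.

Theorem theorem3 (k : nat) (ts : k.-tuple nat)
    (hk : (1 <= k)%N)
    (hpos : forall i : 'I_k, (0 < tnth ts i)%N)
    (hgt : (k < sumn ts)%N) :
  let t := sumn ts in
  let T := (\sum_(i < k) (k - i) * tnth ts i)%N in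
  expansion_at0
    ((-1) ^+ k * q ^ (T%:Z - 'C(k.+1, 2)%:Z)
       * (\sum_(0 <= j < k.+1) qbinom t j * (-1) ^+ j * q ^+ 'C(j.+1, 2)
          - qpoch t)
     / (qbinom t.-1 k * (1 - q ^+ t) * qpoch t))
    (P_series ts).
Proof.
move=> t T.
have ts_pos : all (leq 1) ts by apply/all_tnthP.
have t0 : (0 < sumn ts)%N by apply: leq_trans hgt.
have TE : T = sumn (psums ts).
  rewrite sumn_psums size_tuple; apply: eq_bigr => i _.
  by rewrite (tnth_nth 0%N).
apply: expansion_of_weak.
have := weak_expansion_act 'X^T (shifted_frac_expansion hgt).
rewrite tofrac_Xn => /(@weak_expansion_eq _ _ (P_series ts)).
(* The integer power of q splits into q^T, which acts on the series, and the inverse of q^C(k+1,2),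
   which sits in the denominator of [shifted_frac]. *)
rewrite expfzDr ?q_neq0 // -exprnP -exprnN /shifted_frac -/t invfM.
set S := _ - qpoch t; set D := (_ * _)^-1.
have -> : q ^+ T * ((-1) ^+ k * S * ((q ^+ 'C(k.+1, 2))^-1 * D))
  = (-1) ^+ k * (q ^+ T * (q ^+ 'C(k.+1, 2))^-1) * S * D.
  by rewrite -!mulrA mulrCA [S * (_ * _)]mulrCA.
by apply=> n; rewrite P_series_act // size_tuple TE.
Qed.
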